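(* Let $P$ be a little hybrid path that has at least one special step and whose leftmost special step, at position $b$, is immediately preceded by a downstep (at position $b-1$). Let $(a,b)$ be the special edge of the hybrid matching $M(P)$ with right endpoint $b$, and let $c$ be the transitive left endpoint of the edge of $M(P)$ incident to $b-1$. Then the hybrid matching $M(e(P))$ is obtained from $M(P)$ as follows: replace $(a,b)$ and $(c,b-1)$ with $(a,c+1)$ and $(c,b)$, and slide all half edges incident to vertices from $c+1$ to $b-2$ to the right by one vertex. Precisely: the special edge $(a,b)$ is removed and an ordinary edge $(a,c+1)$ is inserted, and every other edge $(i,j)$ of $M(P)$ is replaced by $(\phi(i),\phi(j))$ (keeping its special or ordinary label), where $\phi(v)=v+1$ for $c+1\le v\le b-1$ and $\phi(v)=v$ for all other vertices $v\ne b$. (In particular, if $(c,b-1)$ is an edge of $M(P)$, it becomes the edge $(c,b)$.)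
   Context: **Paths.** All lattice paths of length $2n$ start at $(0,0)$, end at $(2n,0)$, never go below the $x$-axis, and consist of upsteps U $=(1,1)$, downsteps $(1,-1)$, and double horizontal steps HH $=(2,0)$ (treated as indivisible ''horizontal steps'', occupying two consecutive positions). Each downstep is either ordinary (D) or labeled ''special'' (d). The unit horizontal positions $1,\dots,2n$ index the steps: an upstep or downstep going from $x=i-1$ to $x=i$ is at position $i$, and a horizontal step from $x=i-1$ to $x=i+1$ occupies positions $i,i+1$. An even-special Dyck path is a Dyck path (no horizontal steps) in which an arbitrary subset of the downsteps leaving from even height are labeled special. **Matching upstep.** The upstep matching a downstep $d$ is the rightmost upstep to the left of $d$ that ends at the height from which $d$ leaves. **The map $e$.** If a path has no special steps, $e$ leaves it unchanged. Otherwise take the leftmost special step $s$. (Flatten) If $s$ is immediately preceded by an upstep, replace that upstep and $s$ by one horizontal step HH. (Slide) If $s$ is immediately preceded by a downstep $d$ (necessarily ordinary), let $u$ be the upstep matching $d$ and $Q$ the (possibly empty) subpath strictly between $u$ and $d$; replace the portion $u\,Q\,d\,s$ by HH $Q$ D, with D an ordinary downstep. For little hybrid paths these are the only cases that occur. **Little hybrid paths.** The smallest set of paths containing all even-special Dyck paths and closed under $e$. **Hybrid matching $M(P)$.** For a little hybrid path $P$ of length $2n$, $M(P)$ is a perfect matching of $\{1,\dots,2n\}$ with some edges labeled special, constructed by reading $P$ from left to right: an upstep at position $i$ makes $i$ an opening vertex; a downstep at position $i$ joins $i$ to the nearest (most recent) not yet matched opening vertex to its left; a horizontal step at positions $i,i+1$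 joins $i+1$ to the nearest not yet matched opening vertex to the left of $i$, and makes $i$ an opening vertex (so the two edges at $i,i+1$ cross). An edge is written $(i,j)$ with $i<j$. An edge is special if its right endpoint is the position of a special downstep, otherwise ordinary. **Transitive left endpoint.** In $M(P)$, a pair of edges $(i_1,j_1)$, $(i_2,j_2)$ with $i_1<i_2<j_1<j_2$ is a crossing with left edge $(i_1,j_1)$ and right edge $(i_2,j_2)$ (in $M(P)$ always $j_1=i_2+1$). The transitive left endpoint of an edge is its left endpoint, unless the edge is the right edge of a crossing; in that case it is (recursively) the transitive left endpoint of the left edge of that crossing. *)

(* Defs.v *)
From HB Require Import structures.
From mathcomp Require Import all_boot all_order all_algebra.

Set Implicit Arguments.
Unset Strict Implicit.
Unset Printing Implicit Defensive.

(* Steps: upstep, ordinary downstep, special downstep, and the indivisible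
   double horizontal step. *)
Inductive step := U | D | Sd | HH.

Definition is_up (x : step) : bool := if x is U then true else false.
Definition is_special (x : step) : bool := if x is Sd then true else false.
Definition is_down (x : step) : bool :=
  match x with D | Sd => true | U | HH => false end.
Definition is_horizontal (x : step) : bool := if x is HH then true else false.

Definition step_width (x : step) : nat := if x is HH then 2 else 1.

Definition step_rise (x : step) : int :=
  match x with U => 1 | D | Sd => -1 | HH => 0 end%R.

Definition width (P : seq step) : nat := sumn (map step_width P).
Definition height (P : seq step) : int :=
  foldr (fun x h => step_rise x + h)%R 0%R P.

(* Steps are indexed from 0 in the list, unit horizontal positions from 1: this
   is the position of step k, and the first of its two positions for HH. *)
Definition position (P : seq step) (k : nat) : nat := (width (take k P)).+1.

Definition even_special_dyck (n : nat) (P : seq step) : Prop :=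
  [/\ width P = n.*2,
      ~~ has is_horizontal P,
      forall k, (0 <= height (take k P))%R,
      height P = 0%R
    & forall k, k < size P -> is_special (nth HH P k) ->
        (2 %| height (take k P))%Z].

(* Index in A of the upstep matching a downstep whose preceding subpath is A: the
   rightmost upstep of A ending at the height reached by A. *)
Definition matching_up (A : seq step) : option nat :=
  ohead [seq k <- rev (iota 0 (size A)) |
           is_up (nth HH A k) && (height (take k.+1 A) == height A)].

(* s indexes the leftmost special step, so a downstep just before it is D. Apart
   from the case of no special step, the branches returning P are junk values,
   never reached when starting from even-special Dyck paths. *)
Definition e (P : seq step) : seq step :=
  if has is_special P then
    let s := find is_special P in
    let B := drop s.+1 P in
    if s is r.+1 then
      let A := take r P in
      match nth HH P r with
      | U => A ++ HH :: B
      | D => if matching_up A is Some m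
             then take m A ++ HH :: drop m.+1 A ++ D :: B
             else P
      | _ => P
      end
    else P
  else P.

Inductive little_hybrid (n : nat) : seq step -> Prop :=
| little_hybrid_dyck P : even_special_dyck n P -> little_hybrid n P
| little_hybrid_e P : little_hybrid n P -> little_hybrid n (e P).

(* (i, j, l) is the edge joining i < j, special iff l = true. A matching is a
   duplicate-free list of edges whose order is irrelevant. *)
Definition edge : Type := (nat * nat * bool)%type.

(* st is the list of opening vertices not yet matched, most recent first, and i
   is the position of the next step. The result is None when some vertex cannot
   be matched. *)
Fixpoint matching_from (i : nat) (st : seq nat) (P : seq step) :
    option (seq edge) :=
  match P, st with
  | [::], [::] => Some [::]
  | U :: Q, _ => matching_from i.+1 (i :: st) Q
  | D :: Q, v :: st' =>
      omap (cons (v, i, false)) (matching_from i.+1 st' Q)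
  | Sd :: Q, v :: st' =>
      omap (cons (v, i, true)) (matching_from i.+1 st' Q)
  | HH :: Q, v :: st' =>
      omap (cons (v, i.+1, false)) (matching_from i.+2 (i :: st') Q)
  | _, _ => None
  end.

Definition hybrid_matching (P : seq step) : option (seq edge) :=
  matching_from 1 [::] P.

Definition incident (x : edge) (v : nat) : bool :=
  (x.1.1 == v) || (x.1.2 == v).

(* x is the left edge and y the right edge of a crossing. *)
Definition crossing (x y : edge) : bool :=
  [&& x.1.1 < y.1.1, y.1.1 < x.1.2 & x.1.2 < y.1.2].

(* trans_left M y c: c is the transitive left endpoint in M of the edge y. *)
Inductive trans_left (M : seq edge) : edge -> nat -> Prop :=
| trans_left_end y :
    (forall x, x \in M -> ~~ crossing x y) -> trans_left M y y.1.1
| trans_left_cross x y c :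
    x \in M -> crossing x y -> trans_left M x c -> trans_left M y c.

Definition slide (b c v : nat) : nat :=
  if (c.+1 <= v) && (v <= b.-1) then v.+1 else v.

Definition slide_edge (b c : nat) (x : edge) : edge :=
  (slide b c x.1.1, slide b c x.1.2, x.2).

(* Main.v *)
Require Import Defs.
From mathcomp Require Import all_boot all_order all_algebra.
From mathcomp Require Import zify.

(* Write the path as A U Q D Sd B, with U matching D; then e turns it into
   A HH Q D B. Reading A and B gives the same edges and the same stack in both
   cases. If a is on top of the stack after A, then U Q D Sd pushes the position
   c of U, runs Q above a, and closes the two top vertices x and a, whereas
   HH Q D first closes a at c + 1, pushes c, and then runs the same Q one vertex
   further to the right. Each horizontal step of Q at the level of U replaces
   the vertex just above a by the right edge of a crossing, so the transitive
   left endpoint of the edge closed by D is c. That a exists, i.e. that HH is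
   not at height 0, follows from the invariant that in a little hybrid path
   horizontal steps have positive height and special steps leave from even
   height. *)

Set Implicit Arguments.
Unset Strict Implicit.
Unset Printing Implicit Defensive.

(** * Heights along a path *)

(* The height reached from h, or None if a downstep leaves from height <= f, a
   special one from odd height, or a horizontal step is at height 0. *)
Fixpoint climb (f h : nat) (P : seq step) : option nat :=
  match P with
  | [::] => Some h
  | U :: Q => climb f h.+1 Q
  | D :: Q => if f < h then climb f h.-1 Q else None
  | Sd :: Q => if (f < h) && ~~ odd h then climb f h.-1 Q else None
  | HH :: Q => if 0 < h then climb f h Q else None
  end.

Lemma width_cat A B : width (A ++ B) = width A + width B.
Proof. by rewrite /width map_cat sumn_cat. Qed.

Lemma height_cat A B : (height (A ++ B) = height A + height B)%R.
Proof.
rewrite /height; elim: A => [|x A IH] /=; first by rewrite GRing.add0r.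
by rewrite IH GRing.addrA.
Qed.

Lemma climb_cat f h A B :
  climb f h (A ++ B) = obind (fun g => climb f g B) (climb f h A).
Proof. by elim: A h => [|[] A IH] h //=; case: ifP. Qed.

Lemma climb_height f h A g :
  climb f h A = Some g -> (g%:Z = h%:Z + height A)%R.
Proof.
elim: A h => [|x A IH] h; first by case=> ->; rewrite GRing.addr0.
rewrite /height /= -/(height A).
by case: x => /=; try case: ifP => // h0; move/IH; lia.
Qed.

Lemma climb_ge f h A g : f <= h -> climb f h A = Some g -> f <= g.
Proof.
elim: A h => [|x A IH] h fh; first by case=> <-.
by case: x => /=; try case: ifP => // h0; apply: IH => //; lia.
Qed.

(** Above a positive floor every horizontal step is legal both before and after the shift by [j].
    With special steps excluded no parity test occurs, so only relative heights matter. *)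
Lemma climb_shift f h j Q : 0 < f <= h -> ~~ has is_special Q ->
  climb (j + f) (j + h) Q = omap (addn j) (climb f h Q).
Proof.
elim: Q h => [|x Q IH] h // fh /=; rewrite negb_or => /andP [xS QS].
case: x xS => //= _.
- by rewrite -addnS IH //; lia.
- rewrite ltn_add2l; case: ifP => // h0.
  by rewrite -IH //; [congr climb; lia | lia].
- have -> : 0 < j + h by lia.
  have -> : 0 < h by lia.
  exact: IH.
Qed.

Lemma climb_weaken f g h h' Q :
  g <= f -> climb f h Q = Some h' -> climb g h Q = Some h'.
Proof.
move=> gf; elim: Q h => [|x Q IH] h //.
case: x => /=; first exact: IH.
- by case: ifP => // fh; rewrite (leq_ltn_trans gf fh); apply: IH.
- by case: ifP => // /andP [fh ->]; rewrite (leq_ltn_trans gf fh); apply: IH.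
- by case: ifP => // _; apply: IH.
Qed.

(** Turns the conditions on prefixes of an even-special Dyck path into a successful [climb]. The
    starting height varies for the induction on the first step. *)
Lemma climb_dyck h P :
  ~~ has is_horizontal P ->
  (forall k, (0 <= h%:Z + height (take k P))%R) ->
  (forall k, k < size P -> is_special (nth HH P k) ->
     (2 %| (h%:Z + height (take k P))%R)%Z) ->
  exists g, climb 0 h P = Some g.
Proof.
elim: P h => [|x P IH] h; first by exists h.
rewrite [has _ _]/= negb_or => /andP [xH PH] pos ev.
have step0 g : (g%:Z = h%:Z + step_rise x)%R -> exists g', climb 0 g P = Some g'.
  move=> gE; apply: IH => // [k|k kP kS].
    by have := pos k.+1; rewrite /height /= -/(height _); lia.
  have := ev k.+1 kP kS; rewrite /height /= -/(height _).
  by rewrite gE GRing.addrA.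
have := pos 1; rewrite /= take0 /height /=.
case: x xH step0 pos ev => //= _ step0 _ ev pos1.
- by apply: step0; lia.
- have -> : 0 < h by lia.
  by apply: step0; lia.
- have := ev 0 isT isT; rewrite /height /= GRing.addr0 dvdzE dvdn2 /= => ->.
  have -> : 0 < h by lia.
  by apply: step0; lia.
Qed.

(** * Matching upsteps *)

(** [Q] never falls below its starting height, which is also its final height. Every upstep inside
    [Q] thus ends strictly above the final height, and the displayed [U] is the rightmost
    candidate. *)
Lemma matching_up_cat A Q f : climb f.+1 f.+1 Q = Some f.+1 ->
  matching_up (A ++ U :: Q) = Some (size A).
Proof.
move=> hQ; rewrite /matching_up size_cat /= iotaD add0n /= rev_cat filter_cat.
have hQ0 : height Q = 0%R by have := climb_height hQ; lia.
have hAQ : (height (A ++ U :: Q) = height A + 1)%R.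
  by rewrite height_cat [height (U :: _)]/= -/(height Q) hQ0.
rewrite rev_cons filter_rcons filter_rev.
have -> : [seq k <- iota (size A).+1 (size Q) |
    is_up (nth HH (A ++ U :: Q) k)
    && (height (take k.+1 (A ++ U :: Q)) == height (A ++ U :: Q))] = [::].
  apply/eqP; rewrite -(negbK (_ == _)) -has_filter; apply/hasPn => k.
  rewrite mem_iota => /andP [k1 k2].
  have [j kE] : exists j, k = (size A + j.+1) by exists (k - (size A).+1); lia.
  rewrite {}kE in k1 k2 *.
  rewrite nth_cat take_cat ltnNge leq_addr /= addKn /=.
  have -> : ((size A + j.+1).+1 < size A) = false by lia.
  have -> : (size A + j.+1).+1 - size A = j.+2 by lia.
  rewrite /= hAQ height_cat [height (U :: _)]/= -/(height _).
  have jQ : j < size Q by lia.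
  rewrite (take_nth HH jQ).
  case E: (nth HH Q j) => //=; apply/eqP.
  rewrite -cats1 height_cat /=.
  have [l hl] : exists l, climb f.+1 f.+1 (take j Q) = Some l.
    move: hQ; rewrite -{1}(cat_take_drop j Q) climb_cat.
    by case: climb => // l _; exists l.
  have := climb_height hl; have := climb_ge (leqnn _) hl.
  by rewrite /height /=; lia.
have hU: take (size A).+1 (A ++ U :: Q) = A ++ [:: U].
  by rewrite take_cat ltnNge leqnSn /= subSnn /= take0.
by rewrite nth_cat ltnn subnn /= hAQ hU height_cat eqxx.
Qed.

(** Last-passage decomposition, by induction on the last step. An upstep ending at [l] is the cut;
    otherwise [l] is at most the height before the last step, which is appended to [Q]. *)
Lemma climb_last_up A h l : climb 0 0 A = Some h -> 0 < l <= h ->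
  exists B Q, [/\ A = B ++ U :: Q, climb 0 0 B = Some l.-1
                & climb l l Q = Some h].
Proof.
elim/last_ind: A h => [|A x IH] h; first by case=> <-; lia.
rewrite -cats1 climb_cat; case E: (climb 0 0 A) => [g|] //= hx lh.
case xU: (is_up x).
  case: x xU hx => //= _ [gh].
  have [lE|ln] := eqVneq l h.
    exists A, [::]; rewrite E lE; split=> //; congr Some; lia.
  have [||B [Q [-> hB hQ]]] := IH g; [by []|lia|].
  exists B, (Q ++ [:: U]); rewrite -catA hB climb_cat hQ /=.
  by split=> //; congr Some.
have hg : h <= g.
  by case: x hx xU => //=; case: ifP => // _ [<-] _; rewrite ?leq_pred.
have [||B [Q [-> hB hQ]]] := IH g; [by []|lia|].
exists B, (Q ++ [:: x]); rewrite -catA hB climb_cat hQ; split=> //.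
case: x hx xU => //=.
- case: ifP => // g0 [gh] _.
  have -> : l < g by lia.
  by rewrite gh.
- case: ifP => // /andP [g0 ->] [gh] _.
  have -> : l < g by lia.
  by rewrite gh.
Qed.

(** The last upstep to the final height is the matching one. Free of special steps, [Q] can be
    lowered from level [h.+1] to level 1, ready to be read over a single stack vertex. *)
Lemma matching_up_split A h : ~~ has is_special A -> climb 0 0 A = Some h.+1 ->
  exists B Q, [/\ A = B ++ U :: Q, matching_up A = Some (size B),
                  climb 0 0 B = Some h & climb 1 1 Q = Some 1].
Proof.
move=> AS hA; have [//|B [Q [AE hB hQ]]] := climb_last_up hA (l := h.+1).
  by rewrite leqnn.
move: AS; rewrite AE has_cat /= => /norP [BS QS].
exists B, Q; split=> //.
  exact: matching_up_cat hQ.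
have := @climb_shift 1 1 h Q isT QS; rewrite addn1 hQ.
by case: climb => //= g [hg]; congr Some; lia.
Qed.

(** * The leftmost special step and the map [e] *)

Variant special_split (P : seq step) : Prop :=
  SpecialSplit A B of P = A ++ Sd :: B & ~~ has is_special A
                    & find is_special P = size A.

Lemma has_special_split P : has is_special P -> special_split P.
Proof.
move=> PS; have fP := PS; rewrite has_find in fP.
apply: (@SpecialSplit P (take (find is_special P) P) (drop (find is_special P).+1 P)).
- rewrite -{1}(cat_take_drop (find is_special P) P) (drop_nth HH fP).
  by have := nth_find HH PS; case: nth.
- by rewrite has_take_leq ?ltnn // ltnW.
- by rewrite size_takel // ltnW.
Qed.

Lemma find_special A B : ~~ has is_special A ->
  find is_special (A ++ Sd :: B) = size A.
Proof. by move=> AS; rewrite find_cat (negbTE AS) /= addn0. Qed.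

Lemma e_rcons A x B : ~~ has is_special (rcons A x) ->
  e (rcons A x ++ Sd :: B) =
  match x with
  | U => A ++ HH :: B
  | D => if matching_up A is Some m
         then take m A ++ HH :: drop m.+1 A ++ D :: B
         else rcons A x ++ Sd :: B
  | _ => rcons A x ++ Sd :: B
  end.
Proof.
move=> AS; rewrite /e has_cat orbT find_special // size_rcons.
rewrite drop_cat size_rcons ltnNge leqnSn /= subSnn /= drop0.
by rewrite cat_rcons take_size_cat // nth_cat ltnn subnn.
Qed.

Lemma e_slide A Q B : ~~ has is_special (A ++ U :: Q) ->
  matching_up (A ++ U :: Q) = Some (size A) ->
  e (A ++ U :: Q ++ D :: Sd :: B) = A ++ HH :: Q ++ D :: B.
Proof.
move=> S mA; have := @e_rcons (A ++ U :: Q) D B.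
rewrite has_rcons mA take_size_cat // drop_cat ltnNge leqnSn /= subSnn /= drop0.
by rewrite cat_rcons -catA => ->.
Qed.

(** A flattened upstep ends at even height, so its horizontal replacement lies at odd, hence
    positive, height. In a slide the matching upstep starts at the height from which the special
    step leaves, which is again positive. *)
Lemma little_hybrid_climb n P : little_hybrid n P -> climb 0 0 P = Some 0.
Proof.
elim=> {}P => [[_ PH pos P0 ev]|_ hP].
  have [|k|g hg] := @climb_dyck 0 P PH.
  - by move=> k; rewrite GRing.add0r.
  - by rewrite GRing.add0r; apply: ev.
  - by have := climb_height hg; rewrite P0 hg => -[->].
have [PS|PS] := boolP (has is_special P); last by rewrite /e (negbTE PS).
case: (has_special_split PS) => {PS} A B PE AS _; rewrite {}PE in hP *.
case/lastP: A hP AS => [|A x] // hP AS.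
move: hP; rewrite {1}cat_rcons climb_cat.
case hA: (climb 0 0 A) => [h|] //= hP.
rewrite e_rcons //; move: AS; rewrite has_rcons => /norP [xS AS].
case: x xS hP => //= _; last first.
(* Here the special step follows a horizontal one and [e] returns the path unchanged. *)
- by rewrite cat_rcons climb_cat hA.
- case: ifP => // h0; case: ifP => // /andP [h1 h2] hB.
  case: h h0 h1 h2 hA hB => // h _ /= h1 h2 hA hB.
  have [A1 [Q [AE -> hA1 hQ]]] := matching_up_split AS hA.
  rewrite {}AE in hA AS *.
  rewrite take_size_cat // drop_cat ltnNge leqnSn /= subSnn /= drop0.
  rewrite climb_cat hA1 /= h1 climb_cat.
  have QS : ~~ has is_special Q by move: AS; rewrite has_cat /= => /norP [].
  have := @climb_shift 1 1 h.-1 Q isT QS; rewrite hQ /= addn1 prednK //.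
  by move/(climb_weaken (leq0n _)) => -> /=; rewrite h1.
- case: ifP => // h1 hB; rewrite climb_cat hA /=.
  by have -> : 0 < h by move: h1 => /=; case: (h).
Qed.

(** * Reading the matching off a path with a stack *)

(* Reading the steps from position i with stack st emits the edges E and leaves
   the stack st'; downsteps must leave at least f vertices on the stack. *)
Inductive reads (f : nat) :
    nat -> seq nat -> seq step -> seq edge -> seq nat -> Prop :=
| reads_nil i st : reads f i st [::] [::] st
| reads_up i st P E st' :
    reads f i.+1 (i :: st) P E st' -> reads f i st (U :: P) E st'
| reads_down i v st x P E st' :
    is_down x -> f <= size st -> reads f i.+1 st P E st' ->
    reads f i (v :: st) (x :: P) ((v, i, is_special x) :: E) st'
| reads_horizontal i v st P E st' :
    reads f i.+2 (i :: st) P E st' ->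
    reads f i (v :: st) (HH :: P) ((v, i.+1, false) :: E) st'.

(** The stack size is the current height, so each step that pops finds a vertex. *)
Lemma climb_reads f i st P h : climb f (size st) P = Some h ->
  exists E st', reads f i st P E st' /\ size st' = h.
Proof.
elim: P i st => [|x P IH] i st /=.
  by case=> <-; exists [::], st; split=> //; constructor.
case: x => [|||].
- by move/(IH i.+1 (i :: st)) => [E [st' [r s]]]; exists E, st'; split=> //; constructor.
- case: st => // v st; case: ifP => //= fs /(IH i.+1 st) [E [st' [r s]]].
  by exists ((v, i, false) :: E), st'; split=> //; apply: (@reads_down f i v st D).
- case: st => // v st; case: ifP => //= /andP [fs _] /(IH i.+1 st) [E [st' [r s]]].
  by exists ((v, i, true) :: E), st'; split=> //; apply: (@reads_down f i v st Sd).
- case: st => // v st /= /(IH i.+2 (i :: st)) [E [st' [r s]]].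
  by exists ((v, i.+1, false) :: E), st'; split=> //; constructor.
Qed.

Lemma reads_cat f i st A E st' B F st'' :
  reads f i st A E st' -> reads f (i + width A) st' B F st'' ->
  reads f i st (A ++ B) (E ++ F) st''.
Proof.
rewrite /width; elim=> {i st A E st'} /=.
- by move=> i st; rewrite addn0.
- by move=> i st P E st' _ IH; rewrite addnA addn1 => /IH; constructor.
- move=> i v st x P E st' xd fs _ IH.
  have -> : step_width x = 1 by case: (x) xd.
  by rewrite addnA addn1 => /IH; constructor.
- move=> i v st P E st' _ IH.
  by rewrite addnA addn2 => /IH; constructor.
Qed.

Lemma reads_matching f i st P E :
  reads f i st P E [::] -> matching_from i st P = Some E.
Proof.
have gen st' : reads f i st P E st' -> st' = [::] -> matching_from i st P = Some E.
  elim=> {i st P E st'} /=.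
  - by move=> i st ->.
  - by move=> i st P E st' _ IH /IH.
  - by move=> i v st [] // P E st' _ _ _ IH /IH ->.
  - by move=> i v st P E st' _ IH /IH ->.
by move/gen; apply.
Qed.

(** A reading never touches what lies under its stack. Hence [Q], read over one vertex, can be
    placed above the stack left by [A]. *)
Lemma reads_frame f i st P E st' s :
  reads f i st P E st' -> reads 0 i (st ++ s) P E (st' ++ s).
Proof. by elim=> {i st P E st'} /=; constructor. Qed.

(** Positions inside the run must slide by one, while vertices already on the stack may be renamed
    freely. This lets the bottom vertex stay in place. *)
Lemma reads_map f i st P E st' (phi : nat -> nat) :
  reads f i st P E st' ->
  (forall v, i <= v < i + width P -> phi v = v.+1) ->
  reads f i.+1 (map phi st) P
    [seq (phi x.1.1, phi x.1.2, x.2) | x <- E] (map phi st').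
Proof.
elim=> {i st P E st'}.
- by constructor.
- move=> i st P E st' _ IH ph; constructor.
  move: IH; rewrite /= (ph i); last by rewrite /width /=; lia.
  by apply=> v hv; apply: ph; move: hv; rewrite /width /=; lia.
- move=> i v st x P E st' xd fs _ IH ph /=.
  have w1 : step_width x = 1 by case: (x) xd.
  rewrite (ph i); last by rewrite /width /= w1; lia.
  constructor; rewrite ?size_map //; apply: IH => u hu; apply: ph.
  by move: hu; rewrite /width /= w1; lia.
- move=> i v st P E st' _ IH ph /=.
  rewrite (ph i.+1); last by rewrite /width /=; lia.
  constructor; move: IH; rewrite /= (ph i); last by rewrite /width /=; lia.
  by apply=> u hu; apply: ph; move: hu; rewrite /width /=; lia.
Qed.

Lemma reads_bounds f i st P E st' : reads f i st P E st' -> {in st, forall v, v < i} ->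
  {in st', forall v, v < i + width P /\ (v \in st \/ i <= v)} /\
  {in E, forall x, [/\ i <= x.1.2 < i + width P, x.1.1 < x.1.2
                     & x.1.1 \in st \/ i <= x.1.1]}.
Proof.
elim=> {i st P E st'}.
- move=> i st lt; rewrite /width addn0; split=> // v vs.
  by split; [exact: lt | left].
- move=> i st P E st' _ IH lt.
  have [|lt' IE] := IH.
    by move=> v; rewrite inE => /orP [/eqP -> //|/lt]; lia.
  have sub v : v \in i :: st \/ i < v -> v \in st \/ i <= v.
    by rewrite inE => -[/orP [/eqP ->|]|]; [right|left|right; lia].
  split=> [v /lt' [h1 /sub h2]|x /IE [h1 h2 /sub h3]].
    by split=> //; move: h1; rewrite /width /=; lia.
  by split=> //; move: h1; rewrite /width /=; lia.
- move=> i v st x P E st' xd fs _ IH lt.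
  have w1 : step_width x = 1 by case: (x) xd.
  have [|lt' IE] := IH.
    by move=> u us; have := lt u; rewrite inE us orbT; lia.
  have sub u : u \in st \/ i < u -> u \in v :: st \/ i <= u.
    by rewrite inE => -[->|]; [left; rewrite orbT|right; lia].
  have vi : v < i by apply: lt; rewrite mem_head.
  split=> [u /lt' [h1 /sub h2]|y].
    by split=> //; move: h1; rewrite /width /= w1; lia.
  rewrite inE => /orP [/eqP -> /=|/IE [h1 h2 /sub h3]].
    by rewrite mem_head /width /= w1; split=> //; [lia|left].
  by split=> //; move: h1; rewrite /width /= w1; lia.
- move=> i v st P E st' _ IH lt.
  have vi : v < i by apply: lt; rewrite mem_head.
  have [|lt' IE] := IH.
    move=> u; rewrite inE => /orP [/eqP -> //|us].
    by have := lt u; rewrite inE us orbT; lia.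
  have sub u : u \in i :: st \/ i.+1 < u -> u \in v :: st \/ i <= u.
    by rewrite !inE => -[/orP [/eqP ->|->]|]; [right|left; rewrite orbT|right; lia].
  split=> [u /lt' [h1 /sub h2]|y].
    by split=> //; move: h1; rewrite /width /=; lia.
  rewrite inE => /orP [/eqP -> /=|/IE [h1 h2 /sub h3]].
    by rewrite mem_head /width /=; split=> //; [lia|lia|left].
  by split=> //; move: h1; rewrite /width /=; lia.
Qed.

(** Edges are emitted in increasing order of their right endpoints. *)
Lemma reads_right_inj f i st P E st' : reads f i st P E st' ->
  {in st, forall v, v < i} -> {in E &, injective (fun x => x.1.2)}.
Proof.
have cons_inj (x : edge) F : {in F, forall y, x.1.2 < y.1.2} ->
    {in F &, injective (fun y => y.1.2)} ->
    {in x :: F &, injective (fun y : edge => y.1.2)}.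
  move=> lt inj y z; rewrite !inE => /orP [/eqP ->|yF] /orP [/eqP ->|zF] //.
  - by move=> eq; have := lt z zF; rewrite eq ltnn.
  - by move=> eq; have := lt y yF; rewrite eq ltnn.
  - exact: inj.
elim=> {i st P E st'} //.
- move=> i st P E st' _ IH lt; apply: IH.
  by move=> v; rewrite inE => /orP [/eqP -> //|/lt]; lia.
- move=> i v st x P E st' xd fs r IH lt.
  have lt1 : {in st, forall u, u < i.+1}.
    by move=> u us; have := lt u; rewrite inE us orbT; lia.
  apply: cons_inj; last exact: IH.
  by have [_ h] := reads_bounds r lt1 => y /h [] /=; lia.
- move=> i v st P E st' r IH lt.
  have lt1 : {in i :: st, forall u, u < i.+2}.
    move=> u; rewrite inE => /orP [/eqP -> //|us].
    by have := lt u; rewrite inE us orbT; lia.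
  apply: cons_inj; last exact: IH.
  by have [_ h] := reads_bounds r lt1 => y /h [] /=; lia.
Qed.

(** When [v] is popped, the vertices under it are smaller and give no crossing, and vertices pushed
    after the step lie beyond the closed edge. Only the vertex [i] pushed by a horizontal step falls
    between [v] and [i.+1]. *)
Lemma reads_crossing f i st P E st' : reads f i st P E st' ->
  {in st, forall v, v < i} -> sorted gtn st ->
  {in E &, forall x y, crossing x y -> x.1.2 = y.1.1.+1}.
Proof.
have cons_crossing (x : edge) F : {in F, forall y, x.1.2 < y.1.2} ->
    {in F, forall y, crossing x y -> x.1.2 = y.1.1.+1} ->
    {in F &, forall y z, crossing y z -> y.1.2 = z.1.1.+1} ->
    {in x :: F &, forall y z : edge, crossing y z -> y.1.2 = z.1.1.+1}.
  move=> lt hx h y z; rewrite !inE => /orP [/eqP ->|yF] /orP [/eqP ->|zF].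
  - by rewrite /crossing ltnn.
  - exact: hx.
  - by have := lt y yF; rewrite /crossing; lia.
  - exact: h.
have gtn_trans : transitive gtn by move=> a b c /=; lia.
elim=> {i st P E st'} //.
- move=> i st P E st' _ IH lt so; apply: IH.
    by move=> v; rewrite inE => /orP [/eqP -> //|/lt]; lia.
  by rewrite /= path_sortedE // so andbT; apply/allP => v /lt.
- move=> i v st x P E st' xd fs r IH lt.
  rewrite /= path_sortedE // => /andP [/allP vst so].
  have lt1 : {in st, forall u, u < i.+1}.
    by move=> u us; have := lt u; rewrite inE us orbT; lia.
  have [_ h] := reads_bounds r lt1.
  apply: cons_crossing; last exact: IH.
    by move=> y /h [] /=; lia.
  by move=> y /h [_ _]; rewrite /crossing /= => -[/vst /=|]; lia.
- move=> i v st P E st' r IH lt.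
  rewrite /= path_sortedE // => /andP [/allP vst so].
  have lt1 : {in i :: st, forall u, u < i.+2}.
    move=> u; rewrite inE => /orP [/eqP -> //|us].
    by have := lt u; rewrite inE us orbT; lia.
  have [_ h] := reads_bounds r lt1.
  apply: cons_crossing.
  + by move=> y /h [] /=; lia.
  + move=> y /h [_ _]; rewrite /crossing /= inE.
    by case=> [/orP [/eqP -> //|/vst /=]|]; lia.
  + apply: IH => //; rewrite /= path_sortedE // so andbT.
    by apply/allP => u us; have := lt u; rewrite inE us orbT => /(_ isT).
Qed.

(** * Transitive left endpoints *)

(** The left edge of a crossing is unique: its right endpoint is determined by [y], and right
    endpoints determine edges. *)
Lemma trans_left_right_edge (M : seq edge) x y c :
  {in M &, injective (fun z => z.1.2)} ->
  {in M &, forall z w, crossing z w -> z.1.2 = w.1.1.+1} ->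
  x \in M -> y \in M -> crossing x y ->
  trans_left M y c <-> trans_left M x c.
Proof.
move=> inj cr xM yM xy; split; last exact: trans_left_cross.
case E: y c / => [w no|z w c zM zw zc].
  by move: (no x xM); rewrite -E xy.
by have -> : x = z; first by apply: inj; rewrite // (cr x y) // E (cr z w) // -E.
Qed.

Lemma trans_left_no_crossing (M : seq edge) y c :
  (forall x, x \in M -> ~~ crossing x y) -> trans_left M y c <-> c = y.1.1.
Proof.
move=> no; split=> [|->]; last exact: trans_left_end.
case E: y c / => // [x w c xM xw _].
by move: (no x xM); rewrite E xw.
Qed.

(* A horizontal step at the bottom of the stack closes the bottom vertex and
   replaces it by the left endpoint of the right edge of the new crossing, so
   the transitive left endpoint of the bottom vertex never changes. *)
Lemma reads_trans_left i st Q E st' (M : seq edge) c :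
  {in M, forall x, x.1.1 < x.1.2} ->
  {in M &, injective (fun z => z.1.2)} ->
  {in M &, forall z w, crossing z w -> z.1.2 = w.1.1.+1} ->
  reads 1 i st Q E st' -> 0 < size st -> {in st, forall v, v < i} ->
  {subset E <= M} ->
  (forall y, y \in M -> y.1.1 = last 0 st ->
     forall d, trans_left M y d <-> d = c) ->
  forall y, y \in M -> y.1.1 = last 0 st' ->
  forall d, trans_left M y d <-> d = c.
Proof.
move=> lr inj cr; elim=> {i st Q E st'} //.
- move=> i st P E st' _ IH s0 lt sub G; apply: IH => //.
    by move=> v; rewrite inE => /orP [/eqP -> //|/lt]; lia.
  by case: st s0 {lt} G.
- move=> i v st x P E st' xd fs _ IH s0 lt sub G; apply: IH => //.
  + by move=> u us; have := lt u; rewrite inE us orbT; lia.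
  + by move=> u uE; apply: sub; rewrite inE uE orbT.
  + by case: st fs {s0 lt} G.
- move=> i v st P E st' _ IH s0 lt sub G; apply: IH => //.
  + move=> u; rewrite inE => /orP [/eqP -> //|us].
    by have := lt u; rewrite inE us orbT; lia.
  + by move=> u uE; apply: sub; rewrite inE uE orbT.
  + case: st {s0} lt G => [|w st] //= lt G y yM yi d.
    have xM : (v, i.+1, false) \in M by apply: sub; rewrite mem_head.
    have vi : v < i by apply: lt; rewrite mem_head.
    rewrite -(G _ xM) //; apply: trans_left_right_edge => //.
    (* The remaining point is that [y] does not end at [i.+1]: it would then be the edge from [v],
       although it starts at [i > v]. *)
    rewrite /crossing /= yi vi ltnSn /= ltn_neqAle -yi lr // andbT yi.
    apply/eqP => eq; have := inj _ _ xM yM eq => yE.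
    by move: yi vi; rewrite -yE /= => ->; rewrite ltnn.
Qed.

(** * The matchings of [P] and [e P] compared *)

Theorem theorem7 (n : nat) (P : seq step) :
  little_hybrid n P ->
  has is_special P ->
  let s := find is_special P in
  0 < s ->
  is_down (nth HH P s.-1) ->
  let b := position P s in
  exists M M' : seq edge,
    [/\ hybrid_matching P = Some M,
        hybrid_matching (e P) = Some M',
        exists a : nat, (a, b, true) \in M,
        exists (x : edge) (c : nat),
          [/\ x \in M, incident x b.-1 & trans_left M x c]
      & forall (a c : nat) (x : edge),
          (a, b, true) \in M ->
          x \in M -> incident x b.-1 -> trans_left M x c ->
          perm_eq M'
            ((a, c.+1, false)
               :: [seq slide_edge b c y | y <- M & y != (a, b, true)])
          /\ (forall l : bool, (c, b.-1, l) \in M -> (c, b, l) \in M')].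
Proof.
move=> /little_hybrid_climb hP PS s.
have [L B PE LS sE] := has_special_split PS; rewrite /s {s}sE.
case/lastP: L PE LS => // L x PE LS _ xD.
(* A special downstep here would precede the leftmost special step. *)
have {}xD : x = D.
  move: xD LS; rewrite PE size_rcons /= cat_rcons nth_cat ltnn subnn has_rcons /=.
  by case: (x).
rewrite {x}xD in PE LS *; set b := position P _.
have {}LS : ~~ has is_special L by move: LS; rewrite has_rcons.
have bE : b = (width L).+2.
  by rewrite /b /position PE take_size_cat // -cats1 width_cat addn1.
clearbody b.
have bK : b.-1.+1 = b by rewrite bE.
rewrite PE cat_rcons climb_cat in hP.
case hL: (climb 0 0 L) hP => [[|h]|] //; rewrite [obind _ _]/=.
case: ifP => // /andP [h0 _] hB.
have [A [Q [LE mL hA hQ]]] := matching_up_split LS hL.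
rewrite {}LE in PE LS mL bE {hL}.
have eE : e P = A ++ HH :: Q ++ D :: B.
  by rewrite PE cat_rcons -catA /= e_slide.
(* The position of the matching upstep, and the first position of the new horizontal step. *)
set c0 := (width A).+1.
have b1 : b.-1 = c0.+1 + width Q by rewrite bE width_cat /c0 /width /=; lia.
have [EA [sA [rA szA]]] : exists EA sA, reads 0 1 [::] A EA sA /\ size sA = h.
  exact: climb_reads.
(* The special step leaves from positive height [h], so the stack after [A] has a top vertex
   [a0]. *)
case: sA szA rA => [sz|a0 sA]; first by rewrite -sz in h0.
case: h h0 {hA} hB => // h _ hB [sz] rA; rewrite /= in hB.
(* With floor 1, [Q] starts and ends with one vertex above [a0]. The final one, [x0], is what the
   downstep at [b.-1] closes. *)
have [EQ [sQ [rQ szQ]]] : exists EQ sQ,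
    reads 1 c0.+1 [:: c0] Q EQ sQ /\ size sQ = 1 by exact: climb_reads.
case: sQ szQ rQ => [|x0 [|]] // _ rQ.
have [EB [sB [rB szB]]] : exists EB sB, reads 0 b.+1 sA B EB sB /\ size sB = 0.
  by apply: climb_reads; rewrite sz.
case: sB szB rB => // _ rB.
have bS : b = (c0.+1 + width Q).+1 by rewrite -b1 bE.
pose M := EA ++ EQ ++ [:: (x0, b.-1, false), (a0, b, true) & EB].
have slide_lo v : v <= c0 -> slide b c0 v = v by rewrite /slide; case: ifP; lia.
have slide_hi v : b < v -> slide b c0 v = v by rewrite /slide; case: ifP; lia.
have slide_mid v : c0 < v < b -> slide b c0 v = v.+1 by rewrite /slide; case: ifP; lia.
(* The horizontal step is one wider than [U], so [D] moves to position [b] and [B] still starts at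
   [b.+1]. *)
pose M' := EA ++ (a0, c0.+1, false) :: map (slide_edge b c0) EQ ++
  (slide b c0 x0, b, false) :: EB.
have rM : reads 0 1 [::] P M [::].
  rewrite PE cat_rcons -catA /=; apply: (reads_cat rA); constructor.
  apply: (@reads_cat _ _ _ _ _ [:: x0, a0 & sA]).
    exact: (reads_frame (a0 :: sA) rQ).
  rewrite add1n -/c0 -b1; apply: (@reads_down _ _ _ _ D) => //.
  by rewrite bK; apply: (@reads_down _ _ _ _ Sd).
have rM' : reads 0 1 [::] (e P) M' [::].
  rewrite eE; apply: (reads_cat rA); constructor.
  apply: (@reads_cat _ _ _ _ _ [:: slide b c0 x0 & sA]).
    have phi v : c0.+1 <= v < c0.+1 + width Q -> slide b c0 v = v.+1.
      by move=> hv; apply: slide_mid; lia.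
    by have := reads_frame sA (reads_map rQ phi); rewrite /= slide_lo.
  rewrite addSn -bS.
  exact: (@reads_down _ _ _ _ D).
have [|boundA1 boundA2] := reads_bounds rA; first by [].
have [|boundQ1 boundQ2] := reads_bounds rQ.
  by move=> v; rewrite inE => /eqP ->.
have ltA v : v \in a0 :: sA -> v < c0 by move=> /boundA1 []; rewrite add1n.
have sAb v : v \in sA -> v < b.+1.
  by move=> vs; have := ltA v; rewrite inE vs orbT; lia.
have [_ boundB] := reads_bounds rB sAb.
have a0c : a0 < c0 by apply: ltA; rewrite mem_head.
have [x0b x0c] : x0 < b.-1 /\ c0 <= x0.
  have [] := boundQ1 x0 (mem_head _ _); rewrite b1 inE => -> h1; split=> //.
  by case: h1 => [/eqP -> //|/ltnW].
have EA_lt y : y \in EA -> y.1.1 < y.1.2 < c0.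
  by move=> /boundA2 [h1 h2 _]; rewrite h2; move: h1; rewrite add1n => /andP [].
have EQ_lt y : y \in EQ -> [/\ c0 <= y.1.1, y.1.1 < y.1.2 & y.1.2 < b.-1].
  move=> /boundQ2 []; rewrite -b1 inE => /andP [_ ->] -> h1; split=> //.
  by case: h1 => [/eqP -> //|/ltnW].
have EB_lt y : y \in EB -> [/\ y.1.1 < c0 \/ b < y.1.1, y.1.1 < y.1.2 & b < y.1.2].
  move=> /boundB [/andP [h1 _] h2 h3]; split=> //.
  by case: h3 => [ys|]; [left; apply: ltA; rewrite inE ys orbT|right].
have M_lt : {in M, forall y, y.1.1 < y.1.2}.
  by move=> y yM; have [//|_ bM] := reads_bounds rM; have [] := bM y yM.
have inj : {in M &, injective (fun y => y.1.2)} by apply: (reads_right_inj rM).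
have cr : {in M &, forall y z, crossing y z -> y.1.2 = z.1.1.+1}.
  by apply: (reads_crossing rM).
have MP y : y \in M ->
    y \in EA \/ y \in EQ \/ y = (x0, b.-1, false) \/ y = (a0, b, true) \/ y \in EB.
  rewrite !mem_cat !inE => /orP [|/orP [|/or3P [/eqP|/eqP|]]]; auto 6.
have xM : (x0, b.-1, false) \in M by rewrite !mem_cat mem_head !orbT.
have aM : (a0, b, true) \in M by rewrite !mem_cat !inE eqxx !orbT.
(* A left edge crossing [y] would start before [c0] and end at [c0.+1]. Edges of [EA] end too early,
   those of [EQ] and the one from [x0] start too late, and the others end at [b] or later. *)
have c0_trans y : y \in M -> y.1.1 = c0 -> forall d, trans_left M y d <-> d = c0.
  move=> yM yc d; rewrite trans_left_no_crossing ?yc // => z zM; apply/negP => zy.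
  have := cr z y zM yM zy; move: zy; rewrite /crossing yc => /and3P [zc _ _] zr.
  move: zc zr; case: (MP z zM) => [/EA_lt|[/EQ_lt []|[->|[->|/EB_lt []]]]] /=; lia.
have x_trans d : trans_left M (x0, b.-1, false) d <-> d = c0.
  apply: (reads_trans_left M_lt inj cr rQ) => //.
  - by move=> v; rewrite inE => /eqP ->.
  - by move=> y yE; rewrite !mem_cat yE orbT.
exists M, M'; split.
- exact: reads_matching rM.
- exact: reads_matching rM'.
- by exists a0.
- exists (x0, b.-1, false), c0; split=> //; last exact/x_trans.
  by rewrite /incident eqxx orbT.
move=> a c x aM' xM' xb.
have -> : a = a0 by have [] := inj _ _ aM' aM erefl.
(* No edge has [b.-1] as its left endpoint, and only one has it as its right endpoint. *)
have -> : x = (x0, b.-1, false).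
  case/orP: xb => /eqP xb; last exact: inj.
  by case: (MP x xM') xb => [/EA_lt|[/EQ_lt []|[->|[->|/EB_lt []]]]] /=; lia.
move/x_trans=> -> {a aM' c x xM' xb}.
have perm : perm_eq M'
    ((a0, c0.+1, false) :: [seq slide_edge b c0 y | y <- M & y != (a0, b, true)]).
  have fA : map (slide_edge b c0) EA = EA.
    apply: map_id_in => -[[u v] l] /EA_lt /= uv.
    by rewrite /slide_edge /= !slide_lo //; lia.
  have fB : map (slide_edge b c0) EB = EB.
    apply: map_id_in => -[[u v] l] /EB_lt [/= uc _ bv].
    rewrite /slide_edge /= (slide_hi v) //.
    by case: uc => uc; [rewrite slide_lo // ltnW | rewrite slide_hi].
  have keep s : (forall y, y \in s -> y.1.2 != b) ->
      [seq y <- s | y != (a0, b, true)] = s.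
    move=> ne; apply/all_filterP/allP => y /ne; apply: contraNneq => ->.
    by rewrite eqxx.
  rewrite /M !filter_cat /= eqxx !keep.
  - have -> : (x0, b.-1, false) != (a0, b, true) by apply/eqP => -[_ _].
    rewrite !map_cat /= fA fB /slide_edge /= (slide_mid b.-1); last by lia.
    (* Both lists now agree up to the place of the new edge from [a0]. *)
    by rewrite bK /M' -cat1s (perm_catCA EA [:: _]).
  - by move=> y /EB_lt [_ _ /gtn_eqF ->].
  - by move=> y /EQ_lt [_ _ yb]; rewrite ltn_eqF // (leq_trans yb) ?leq_pred.
  - by move=> y /EA_lt /andP [_ yc]; rewrite ltn_eqF // (ltn_trans yc) // bS; lia.
split=> // l cM; rewrite (perm_mem perm) inE; apply/orP; right.
apply/mapP; exists (c0, b.-1, l).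
  by rewrite mem_filter cM andbT; apply/eqP => -[]; rewrite bS /=; lia.
by rewrite /slide_edge /= slide_lo // slide_mid bS //=; lia.
Qed.
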